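(* Let $(q_j)$ and $(t_j)$ be sequences of integers with $q_j\to\infty$ and $2\le t_j\le q_j$, and put $r_j=q_j+1$, $D_j=t_jq_j+1$. For each $j$ let $e_j$ be an edge of a finite linear $C^{r_j}_{1,t_j+1}$-free $r_j$-uniform hypergraph $H_j$. Assume $$\frac{t_j^2}{q_j}\longrightarrow 0,\qquad t_j^3\,\delta_{H_j}(e_j)\longrightarrow 0 .$$ Then, for every fixed $0<\theta<1$, $$\frac{\bigl|\{f\in E(H_j): f\ne e_j,\ f\cap e_j\ne\varnothing,\ \delta_{H_j}(f)\ge\theta/t_j^2\}\bigr|}{r_j(D_j-1)}\longrightarrow 1 .$$
   Context: A hypergraph is $r$-uniform if every edge is an $r$-element set of vertices, and linear if any two distinct edges share at most one vertex. $d_H(v)$ is the number of edges of $H$ containing $v$. For $3\le k\le r$ the crown $C^r_{1,k}$ consists of a base edge $e_0$ and pairwise disjoint edges (petals) $e_1,\dots,e_k$ with $e_0\cap e_i=\{v_i\}$, where $v_1,\dots,v_k$ are distinct points of $e_0$; $H$ is $C^r_{1,k}$-free if it contains no such configuration of edges. With $r=q+1$, $k=t+1$, $D=tq+1$, the defect of an edge $f$ of a linear $C^{q+1}_{1,t+1}$-free $(q+1)$-uniform hypergraph $H$ is $\delta_H(f)=\sum_{v\in f}\frac1{d_H(v)}-\frac{r}{D}$. For $H_j$ the defect is taken with parameters $q_j,t_j$, i.e. $\delta_{H_j}(f)=\sum_{v\in f}\frac{1}{d_{H_j}(v)}-\frac{r_j}{D_j}$. *)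

(* Defs.v *)
From HB Require Import structures.
From mathcomp Require Import all_boot all_order all_algebra.
From mathcomp Require Import reals.

Set Implicit Arguments.
Unset Strict Implicit.
Unset Printing Implicit Defensive.

Import Order.TTheory GRing.Theory Num.Theory.

Local Open Scope ring_scope.

(* A finite hypergraph on the vertex type V is given by its edge set
   E : {set {set V}}. *)
Section Hypergraph.
Variable V : finType.
Implicit Types (E : {set {set V}}) (f : {set V}) (v : V).

Definition uniform (r : nat) E : Prop := forall f, f \in E -> #|f| = r.

Definition linear_hypergraph E : Prop :=
  forall f g, f \in E -> g \in E -> f != g -> (#|f :&: g| <= 1)%N.

Definition hdeg E v : nat := #|[set f in E | v \in f]|.

(* The uniformity r of the crown C^r_{1,k} is that of E. *)
Definition is_crown (k : nat) E (base : {set V}) (petal : 'I_k -> {set V})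
    (pt : 'I_k -> V) : Prop :=
  [/\ base \in E,
      forall i, petal i \in E,
      forall i j, i != j -> petal i :&: petal j = set0,
      forall i, base :&: petal i = [set pt i]
    & injective pt].

Definition crown_free (k : nat) E : Prop :=
  ~ exists base petal pt, @is_crown k E base petal pt.

(* Only meaningful for f \in E, whose vertices all have positive degree
   (0^-1 = 0 in a field). *)
Definition defect (R : realType) (q t : nat) E f : R :=
  \sum_(v in f) (hdeg E v)%:R^-1 - (q + 1)%:R / (t * q + 1)%:R.

End Hypergraph.

(* Main.v *)
Require Import Defs.
From HB Require Import structures.
(* Loaded in this order so that set0, subsetP and the like concern finite sets. *)
From mathcomp Require Import all_classical all_reals all_analysis.
From mathcomp Require Import all_boot all_order all_algebra.
From mathcomp Require Import zify ring lra.

Set Implicit Arguments.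
Unset Strict Implicit.
Unset Printing Implicit Defensive.

(** Write D = tq + 1.  Let e be the edge of small defect; its petals are the
edges f <> e that meet e.

Degrees.  A petal of a base f blocks at most q of the edges through another
vertex of f, so t vertices of f of degree above (t - 1)q + 1 carry t disjoint
petals, and these block at most tq edges at any further vertex v of f.  In the
absence of a crown every edge at v other than f is blocked, whence d(v) <= D
([high_points_degree]).  On the other hand, put c = (1 - theta) / 4: an edge
with at most c q / t vertices of degree above (t - 1 + c)q + 1 has defect about
1 / (t - 1 + c) - 1 / t or more, which exceeds theta / t^2 by enough to cover
the error terms as soon as t^2 / q <= c ([few_high_defect]).  Therefore all
degrees on e are at most D, and the sum Delta of the deficits D - d(v) over
e is at most 4 t^2 q^2 times the defect of e ([total_deficit_defect]).  Thus e
has exactly r(D - 1) - Delta petals, and it remains to show that only o(tq^2) of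
them are low, that is, have defect below theta / t^2.

Low petals produce crossing edges.  Let f be a petal of low defect at v in e.
It has many vertices x of high degree, and many edges g through x miss e.
Greedy choice in base f, started with g, gives t disjoint petals of f, and they
must block all the edges at v; the t - 1 petals other than g block at most
(t - 1)q of them, so g itself meets almost q of the petals of e at v
([last_petal]).  Such an edge g is called crossing.  One low petal yields at
least c^2 q^2 / 2 flags (x, g) with g crossing ([low_flags]), and distinct low
petals at v yield distinct flags ([sum_crossing_flags]).

Crossing edges are rare.  Fix a set P of t disjoint petals of e.  The sheet of
p in P consists of the petals of e that avoid the other members of P.  Two
members of a sheet at different vertices of e meet, for otherwise they would
form a crown with P minus p: together with e, a sheet is nearly a projective
plane of order q.  So if h and h' belong to one sheet at v, then of the q^2
pairs of points in h x h' nearly all are already joined by members of the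
sheet, and at most tq + Delta edges missing e meet both h and h'
([card_outer_transversals]).  But the almost q petals at v that a crossing edge
meets are spread over only t sheets, so that it meets about q^2 / t pairs from a
common sheet.  Counting such pairs in two ways leaves O(t^2 (tq + Delta))
crossing edges at v ([card_crossing]).

Dividing by the number of flags per low petal and summing over v, there are
O(t^2 (tq + Delta)) low petals ([sum_low]).  Relative to tq^2 this is
O(t^2 / q + t^3 defect(e)), which tends to 0 by assumption ([large_ratio]). *)

(** * Counting in families of finite sets *)

Lemma leq_card_bigcup (I T : finType) (A : {pred I}) (F : I -> {set T}) :
  #|\bigcup_(i in A) F i| <= \sum_(i in A) #|F i|.
Proof.
elim/big_rec2: _ => [|i n B _ leBn]; first by rewrite cards0.
by apply: leq_trans (leq_card_setU _ _) _; rewrite leq_add2l.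
Qed.

Lemma sum_card_sets (I T : finType) (A : {set I}) (F : I -> {set T}) :
  \sum_(i in A) #|F i| = \sum_x #|[set i in A | x \in F i]|.
Proof.
under eq_bigr do rewrite -sum1_card.
rewrite (exchange_big_dep predT) //=; apply: eq_bigr => x _.
by rewrite -sum1_card; apply: eq_bigl => i; rewrite inE.
Qed.

Lemma sum_card_disjoint (I T : finType) (A : {set I}) (F : I -> {set T})
    (B : {set T}) :
  (forall i, i \in A -> F i \subset B) ->
  (forall i j x, i \in A -> j \in A -> x \in F i -> x \in F j -> i = j) ->
  \sum_(i in A) #|F i| <= #|B|.
Proof.
move=> sFB inj; rewrite sum_card_sets -sum1_card big_mkcond /=.
rewrite [leqRHS]big_mkcond /=; apply: leq_sum => x _.
case: ifPn => [_|xB].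
  apply/card_le1_eqP => i j; rewrite !inE => /andP[iA xi] /andP[jA xj].
  exact: (inj j i x).
rewrite leqn0 cards_eq0; apply/eqP/setP => i; rewrite !inE.
by apply/negP => /andP[iA xi]; case/negP: xB; apply: (subsetP (sFB i iA)).
Qed.

(** * Petals of a base edge *)

Section Hypergraph.
Variables (V : finType) (E : {set {set V}}) (q t : nat).
Hypothesis E_uniform : uniform (q + 1) E.
Hypothesis E_linear : linear_hypergraph E.
Implicit Types (f g h p e : {set V}) (v w x y : V) (P : {set {set V}}).

(** The candidates for the petal at [v] of a crown with base [f]. *)
Definition star f v := [set h in E | (v \in h) && (h != f)].

Definition meeting f v g := [set h in star f v | ~~ [disjoint h & g]].

(** The petals of a crown with base [f], as an unindexed set: linearity makes
each of them meet [f] in a single point, and disjointness makes these points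
distinct. *)
Definition petal_system f P :=
  [/\ P \subset E,
      forall p, p \in P -> p != f /\ ~~ [disjoint p & f]
    & {in P &, forall p p', p != p' -> [disjoint p & p']}].

Lemma meetP (A B : {set V}) :
  reflect (exists2 x, x \in A & x \in B) (~~ [disjoint A & B]).
Proof.
rewrite -setI_eq0; apply: (iffP (set0Pn _)) => [[x /setIP[xA xB]]|[x xA xB]].
  by exists x.
by exists x; rewrite inE xA.
Qed.

Lemma edge_eq f g x y : f \in E -> g \in E -> x \in f -> y \in f ->
  x \in g -> y \in g -> x != y -> f = g.
Proof.
move=> fE gE xf yf xg yg; apply: contraNeq => fg.
apply/eqP; have /card_le1_eqP := E_linear fE gE fg.
by move=> /(_ y x) ->; rewrite // inE ?xf ?yf.
Qed.

Lemma starP f v h : reflect [/\ h \in E, v \in h & h != f] (h \in star f v).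
Proof. by rewrite inE; apply: and3P. Qed.

Lemma star_meet f v h y :
  f \in E -> v \in f -> h \in star f v -> y \in f -> y \in h -> y = v.
Proof.
move=> fE vf /starP[hE vh hf] yf yh; apply: contraNeq hf => yv.
by rewrite (edge_eq hE fE yh vh yf vf).
Qed.

Lemma star_inj f v g h y : h \in star f v -> g \in star f v ->
  y != v -> y \in g -> y \in h -> g = h.
Proof.
move=> /starP[hE vh _] /starP[gE vg _] yv yg yh.
exact: (edge_eq gE hE yg vg yh vh).
Qed.

Lemma hdeg_star f v : f \in E -> v \in f -> hdeg E v = #|star f v|.+1.
Proof.
move=> fE vf; rewrite /hdeg (cardsD1 f) inE fE vf /= add1n; congr S.
by apply: eq_card => h; rewrite !inE andbC andbA.
Qed.

(** By linearity an edge at [v] is determined by the point where it meets [g];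
that point is not on [f], which leaves [q] points of [g]. *)
Lemma leq_card_meeting f v g : f \in E -> v \in f -> g \in E -> v \notin g ->
  ~~ [disjoint g & f] -> #|meeting f v g| <= q.
Proof.
move=> fE vf gE vg /meetP[z zg zf].
pose pt h := odflt v [pick y in h :&: g].
have ptP h : h \in meeting f v g -> pt h \in h /\ pt h \in g.
  rewrite inE /pt => /andP[_ /meetP[y yh yg]]; case: pickP => /= [u /setIP[]//|].
  by move=> /(_ y); rewrite inE yh yg.
have sub h : h \in meeting f v g -> h \in star f v by rewrite inE => /andP[].
have ptv h : h \in meeting f v g -> pt h != v.
  by move=> /ptP[_]; apply: contraTneq => ->.
rewrite -(card_in_imset (f := pt)); last first.
  move=> h h' hm hm' eq_pt; have [ph _] := ptP _ hm; have [ph' _] := ptP _ hm'.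
  by apply: (star_inj (sub _ hm') (sub _ hm) (ptv _ hm)) => //; rewrite eq_pt.
have <- : #|g :\ z| = q.
  by apply/esym/(@addnI 1); rewrite addnC -(E_uniform gE) (cardsD1 z) zg.
apply: subset_leq_card.
apply/subsetP => _ /imsetP[h hm ->]; have [ph pg] := ptP _ hm.
rewrite !inE pg andbT; apply: contraNneq (ptv _ hm) => pz.
by rewrite (star_meet fE vf (sub _ hm) _ ph) // pz.
Qed.

Lemma leq_card_meetings f v (A : {set {set V}}) P : A \subset star f v ->
  (forall h, h \in A -> exists2 p, p \in P & ~~ [disjoint h & p]) ->
  #|A| <= \sum_(p in P) #|meeting f v p|.
Proof.
move=> sA meetA; apply: leq_trans (leq_card_bigcup _ _).
apply/subset_leq_card/subsetP => h hA; have [p pP hp] := meetA _ hA.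
by apply/bigcupP; exists p => //; rewrite inE (subsetP sA).
Qed.

Section System.
Variables (f : {set V}) (P : {set {set V}}).
Hypotheses (fE : f \in E) (fP : petal_system f P).

Lemma system_meeting v p : v \in f -> v \notin cover P -> p \in P ->
  #|meeting f v p| <= q.
Proof.
move=> vf vP pP; have [PE Pf _] := fP; have [_ pf] := Pf p pP.
apply: leq_card_meeting => //; first exact: (subsetP PE).
by apply: contraNN vP => vp; apply/bigcupP; exists p.
Qed.

Lemma system_add v h : v \in f -> h \in star f v ->
  (forall p, p \in P -> [disjoint h & p]) ->
  petal_system f (h |: P) /\ h \notin P.
Proof.
move=> vf /starP[hE vh hf] hP; have [PE Pf Pdisj] := fP; split; last first.
  by apply/negP => /hP; apply/negP/meetP; exists v.
split=> [|p /setU1P[->|]|p p' /setU1P[->|pP] /setU1P[->|pP']] //.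
- by rewrite subUset sub1set hE.
- by split=> //; apply/meetP; exists v.
- exact: Pf.
- by rewrite eqxx.
- by move=> _; apply: hP.
- by move=> _; rewrite disjoint_sym; apply: hP.
- exact: Pdisj.
Qed.

Definition avoiding v :=
  [set h in star f v | [forall p in P, [disjoint h & p]]].

Lemma leq_card_star v : v \in f -> v \notin cover P ->
  #|star f v| <= #|P| * q + #|avoiding v|.
Proof.
move=> vf vP; rewrite -(cardsID (avoiding v)) addnC leq_add //; last first.
  by rewrite subset_leq_card ?subsetIr.
apply: leq_trans (leq_card_meetings (P := P) (subsetDl _ _) _) _.
  move=> h; rewrite 2!inE => /andP[]; rewrite negb_and => /orP[/negP//|].
  by rewrite negb_forall_in => /exists_inP.
by rewrite -sum_nat_const leq_sum // => p pP; apply: system_meeting.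
Qed.

Lemma system_base_card p : p \in P -> #|f :&: p| <= 1.
Proof.
move=> pP; have [PE Pf _] := fP; have [pf _] := Pf p pP.
by apply: E_linear => //; [exact: (subsetP PE)|rewrite eq_sym].
Qed.

Lemma system_cover_base : #|f :&: cover P| <= #|P|.
Proof.
rewrite setIC /cover big_distrl /=; apply: leq_trans (leq_card_bigcup _ _) _.
rewrite -sum1_card leq_sum // => p pP.
by rewrite setIC system_base_card.
Qed.

End System.

(** * Consequences of crown-freeness *)

Section CrownFree.
Hypothesis E_crown_free : crown_free (t + 1) E.

Lemma system_card f P : f \in E -> petal_system f P -> #|P| <= t.
Proof.
move=> fE fP; have [PE Pf Pdisj] := fP; rewrite leqNgt; apply/negP => ltP.
have leP : t + 1 <= #|P| by lia.
pose pe (i : 'I_(t + 1)) := enum_val (widen_ord leP i).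
have peP i : pe i \in P by apply: enum_valP.
have pe_inj : injective pe.
  by move=> i j /enum_val_inj /(congr1 val) /= ?; apply: val_inj.
have /fin_all_exists[pt ptP] i : exists x, f :&: pe i = [set x].
  apply/cards1P; rewrite eqn_leq (system_base_card fE fP) //=.
  by rewrite card_gt0 setI_eq0 disjoint_sym; case: (Pf _ (peP i)).
have pt_pe i : pt i \in pe i.
  by have /setP/(_ (pt i)) := ptP i; rewrite !inE eqxx => /andP[].
have pe_disj i j : i != j -> [disjoint pe i & pe j].
  by move=> ij; apply: Pdisj => //; apply: contraNneq ij => /pe_inj ->.
apply: E_crown_free; exists f, pe, pt; split=> // [i|i j ij|i j eq_pt].
- exact: (subsetP PE).
- by apply/eqP; rewrite setI_eq0 pe_disj.
case: (eqVneq i j) => // /pe_disj dij.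
suff /negP[] : ~~ [disjoint pe i & pe j] by [].
by apply/meetP; exists (pt i) => //; rewrite eq_pt.
Qed.

(** A system of [t] petals is maximal, so no edge that meets the base can avoid
all its members. *)
Lemma system_blocks f P v h : f \in E -> petal_system f P -> t <= #|P| ->
  v \in f -> h \in star f v -> exists2 p, p \in P & ~~ [disjoint h & p].
Proof.
move=> fE fP tP vf hs; apply/exists_inP; apply: contraT.
rewrite negb_exists_in => /forall_inP disj.
have [|fP' hP] := system_add fP vf hs.
  by move=> p /disj; rewrite negbK.
by have := system_card fE fP'; rewrite cardsU1 hP; lia.
Qed.

(** Greedy choice: fewer than [t] petals block at most [(t - 1) * q] edges at
each unused vertex of [Y]. *)
Lemma system_extend f v P (Y : {set V}) : f \in E -> v \in f ->
  petal_system f P -> v \notin cover P -> Y \subset f :\ v ->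
  (forall y, y \in Y -> (t - 1) * q < #|star f y|) -> t <= #|Y| ->
  exists P',
    [/\ P \subset P', petal_system f P', v \notin cover P' & #|P'| = t].
Proof.
move=> fE vf fP vP sY highY tY.
have [n] := ubnP (t - #|P|); elim: n => // n IHn in P fP vP * => ltn.
have := system_card fE fP; rewrite leq_eqVlt => /predU1P[Pt|ltP].
  by exists P.
have [y yY yP] : exists2 y, y \in Y & y \notin cover P.
  apply/subsetPn; apply/negP => sYP.
  have := leq_trans _ (system_cover_base fE fP); move=> /(_ #|Y|).
  rewrite subset_leq_card; first by lia.
  rewrite subsetI sYP andbT; apply: subset_trans sY _; exact: subsetDl.
have /setD1P[yv yf] := subsetP sY _ yY.
have yP' : #|P| * q < #|star f y|.
  apply: leq_ltn_trans (highY _ yY); rewrite leq_mul2r -ltnS subn1.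
  by rewrite prednK ?ltP ?orbT // (leq_ltn_trans _ ltP).
have /card_gt0P[h] : 0 < #|avoiding f P y|.
  rewrite -(ltn_add2l (#|P| * q)) addn0.
  exact: leq_trans yP' (leq_card_star fE fP yf yP).
rewrite inE => /andP[hs /forall_inP hP].
have [fP' hNP] := system_add fP yf hs hP.
have [||P' [sP' ? ? ?]] := IHn (h |: P) fP'.
- rewrite /cover bigcup_setU big_set1 inE negb_or vP andbT.
  by apply: contraNN yv => vh; rewrite (star_meet fE yf hs vf vh).
- by rewrite cardsU1 hNP; move: ltn ltP; clear; lia.
exists P'; split=> //; apply: subset_trans sP'; exact: subsetUr.
Qed.

(** A petal [g] of [f] extends to [t] disjoint petals away from [v]; they block
all edges at [v], and all of them except [g] block at most [q] each. *)
Lemma last_petal f v x g (Y : {set V}) : 0 < t -> f \in E -> v \in f ->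
  Y \subset f :\ v -> (forall y, y \in Y -> (t - 1) * q < #|star f y|) ->
  t <= #|Y| -> x \in f :\ v -> g \in star f x ->
  #|star f v| <= (t - 1) * q + #|meeting f v g|.
Proof.
move=> t0 fE vf sY highY tY /setD1P[xv xf] gs.
have fP0 : petal_system f finset.set0.
  by split=> [|p|p p']; rewrite ?sub0set ?inE.
have [|fP gP] := system_add fP0 xf gs; first by move=> p; rewrite inE.
have vg : v \notin g.
  by apply: contraNN xv => vg; rewrite (star_meet fE xf gs vf vg).
rewrite finset.setU0 in fP.
have [|P' [gP' fP' vP' P't]] := system_extend fE vf fP _ sY highY tY.
  by rewrite /cover big_set1.
rewrite sub1set in gP'.
have : #|star f v| <= \sum_(p in P') #|meeting f v p|.
  apply: leq_card_meetings => // h hs.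
  by apply: (system_blocks fE fP') hs => //; rewrite P't.
rewrite (big_setD1 g) //= addnC => /leq_trans; apply; rewrite leq_add2r.
have -> : t - 1 = #|P' :\ g| by rewrite -P't (cardsD1 g P') gP' addKn.
rewrite -sum_nat_const leq_sum // => p /setD1P[_ pP'].
exact: (system_meeting fE fP').
Qed.

Lemma high_points_degree f v (Y : {set V}) : 0 < t -> f \in E -> v \in f ->
  Y \subset f :\ v -> (forall y, y \in Y -> (t - 1) * q < #|star f y|) ->
  t <= #|Y| -> #|star f v| <= t * q.
Proof.
move=> t0 fE vf sY highY tY.
have /card_gt0P[x xY] : 0 < #|Y| by lia.
have xf := subsetP sY _ xY; have [xv xf'] := setD1P xf.
have /card_gt0P[g gs] : 0 < #|star f x| by apply: leq_ltn_trans (highY _ xY).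
have [gE xg gf] := starP _ _ _ gs.
apply: leq_trans (last_petal t0 fE vf sY highY tY xf gs) _.
have -> : t * q = (t - 1) * q + q by rewrite -mulSnr subn1 prednK.
rewrite leq_add2l.
apply: leq_card_meeting => //; last by apply/meetP; exists x.
by apply: contraNN xv => vg; rewrite (star_meet fE xf' gs vf vg).
Qed.

Lemma system_sub f P P' :
  petal_system f P -> P' \subset P -> petal_system f P'.
Proof.
move=> [PE Pf Pdisj] sP.
split=> [|p /(subsetP sP)|p p' /(subsetP sP) + /(subsetP sP)].
- exact: subset_trans PE.
- exact: Pf.
- by move=> pP p'P; apply: Pdisj.
Qed.

(** * Sheets over a base edge without large degrees *)

Section BaseEdge.
Variables (e : {set V}) (P : {set {set V}}).
Hypotheses (t_gt0 : 0 < t) (eE : e \in E).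
Hypotheses (eP : petal_system e P) (Pt : #|P| = t).
Hypothesis e_degree : forall v, v \in e -> #|star e v| <= t * q.

Definition deficit v := t * q - #|star e v|.
Definition total_deficit := \sum_(v in e) deficit v.

(** The petals of [e] at [w] that can replace [p] in [P].  When every degree on
[e] is [t * q + 1], the petals of [e] at the vertices off [cover P] split into
[t] sheets, parts of projective planes of order [q] that share the line [e]. *)
Definition sheet p w := avoiding e (P :\ p) w.

Lemma deficitK v : v \in e -> #|star e v| + deficit v = t * q.
Proof. by move=> ve; rewrite subnKC ?e_degree. Qed.

Let card_PD1 p : p \in P -> #|P :\ p| = t - 1.
Proof. by move=> pP; rewrite -Pt (cardsD1 p P) pP addKn. Qed.

Let subPD1 p : petal_system e (P :\ p).
Proof. exact: system_sub eP (subsetDl _ _). Qed.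

Let notin_coverD1 p w : w \notin cover P -> w \notin cover (P :\ p).
Proof.
by apply: contraNN => /bigcupP[r /setD1P[_ rP] wr]; apply/bigcupP; exists r.
Qed.

Lemma sheetP p w h :
  reflect (h \in star e w /\ forall r, r \in P -> r != p -> [disjoint h & r])
    (h \in sheet p w).
Proof.
apply: (iffP setIdP) => -[hs hP]; split=> //.
  by move=> r rP rp; apply: (forall_inP hP); rewrite !inE rp.
by apply/forall_inP => r /setD1P[rp rP]; apply: hP.
Qed.

(** The [t - 1] petals other than [p] block at most [(t - 1) * q] of the
[t * q - deficit w] edges at [w]. *)
Lemma sheet_lower p w : w \in e -> w \notin cover P -> p \in P ->
  q <= #|sheet p w| + deficit w.
Proof.
move=> we wP pP; have := leq_card_star eE (subPD1 p) we (notin_coverD1 p wP).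
rewrite card_PD1 // -/(sheet p w); have := deficitK we.
have -> : t * q = (t - 1) * q + q by rewrite -mulSnr subn1 prednK.
by clear; lia.
Qed.

Lemma sheet_meet_system p w h : w \in e -> p \in P -> h \in sheet p w ->
  ~~ [disjoint h & p].
Proof.
move=> we pP /sheetP[hs hP].
have [|r rP hr] := system_blocks eE eP _ we hs; first by rewrite Pt.
by case: (eqVneq r p) hr => [-> //|rp]; rewrite hP.
Qed.

Lemma sheet_upper p w : w \in e -> w \notin cover P -> p \in P ->
  #|sheet p w| <= q.
Proof.
move=> we wP pP; apply: leq_trans (system_meeting eE eP we wP pP).
apply/subset_leq_card/subsetP => h hp.
by rewrite inE (sheet_meet_system we pP hp) andbT; case/sheetP: hp.
Qed.

Lemma sheet_disjoint p r w h : w \in e -> p \in P -> r \in P ->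
  h \in sheet p w -> h \in sheet r w -> p = r.
Proof.
move=> we pP rP hp /sheetP[_ hr]; apply/eqP; apply: contraT => pr.
by have := sheet_meet_system we pP hp; rewrite hr.
Qed.

(** Otherwise [h] and [h'] together with the [t - 1] petals other than [p]
would be a system of [t + 1] petals. *)
Lemma sheet_meet p w w' h h' : w \in e -> w' \in e -> w != w' -> p \in P ->
  h \in sheet p w -> h' \in sheet p w' -> ~~ [disjoint h & h'].
Proof.
move=> we w'e ww' pP; rewrite inE => /andP[hs /forall_inP hP].
rewrite inE => /andP[h's /forall_inP h'P]; apply/negP => dhh'.
have [h_sys h_new] := system_add (subPD1 p) we hs hP.
have [|h'_sys h'_new] := system_add h_sys w'e h's.
  by move=> r /setU1P[->|/h'P //]; rewrite disjoint_sym.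
have := system_card eE h'_sys.
rewrite cardsU1 h'_new cardsU1 h_new card_PD1 // subn1.
by rewrite !add1n prednK // ltnn.
Qed.

(** An edge avoiding [v] that meets both [h] and [h'] is determined by the two
points where it does so, so there are at most [q * q] of them.  The members of
the sheet at the other vertices of [e] are such edges, and they number at least
[q * (q - t)] minus the total deficit; edges missing [e] are not among them. *)
Lemma card_outer_transversals p v h h' : v \in e -> v \notin cover P ->
  p \in P -> h \in sheet p v -> h' \in sheet p v -> h != h' ->
  #|[set g in E | [&& [disjoint g & e], ~~ [disjoint h & g]
                    & ~~ [disjoint h' & g]]]| <= t * q + total_deficit.
Proof.
move=> ve vP pP hp h'p hh'; set G := [set g in E | _].
have [hs _] := sheetP _ _ _ hp; have [h's _] := sheetP _ _ _ h'p.
have [hE vh _] := starP _ _ _ hs; have [h'E vh' _] := starP _ _ _ h's.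
pose K := [set g in E | [&& v \notin g, ~~ [disjoint h & g]
                          & ~~ [disjoint h' & g]]].
have meet_at k g : k \in star e v -> g \in E -> v \notin g ->
  ~~ [disjoint k & g] -> exists2 y, y \in k :\ v & y \in g.
  move=> ks gE vg /meetP[y yk yg]; exists y => //; rewrite !inE yk andbT.
  by apply: contraNneq vg => <-.
have cardK : #|K| <= q * q.
  pose pt k g := odflt v [pick y in (k :\ v) :&: g].
  have ptP k g : k \in star e v -> g \in E -> v \notin g ->
      ~~ [disjoint k & g] -> pt k g \in k :\ v /\ pt k g \in g.
    move=> ks gE vg kg; rewrite /pt; case: pickP => /= [u /setIP[]//|].
    by have [y yk yg] := meet_at k g ks gE vg kg; move/(_ y); rewrite inE yk yg.
  have card_pts k : k \in star e v -> #|k :\ v| = q.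
    move=> /starP[kE vk _]; apply/esym/(@addnI 1).
    by rewrite addnC -(E_uniform kE) (cardsD1 v) vk.
  rewrite -{1}(card_pts h hs) -(card_pts h' h's) -cardsX.
  rewrite -(card_in_imset (f := fun g => (pt h g, pt h' g))); last first.
    move=> g g' /[!inE] /and4P[gE vg hg h'g] /and4P[g'E vg' hg' h'g'] [eqh eqh'].
    have [/setD1P[yv yh] yg] := ptP h g hs gE vg hg.
    have [/setD1P[_ yh'] yg'] := ptP h' g h's gE vg h'g.
    have [_ zg] := ptP h g' hs g'E vg' hg'.
    have [_ zg'] := ptP h' g' h's g'E vg' h'g'.
    apply: (edge_eq gE g'E yg yg'); rewrite ?eqh ?eqh' //.
    rewrite -eqh -eqh'; apply: contraNneq hh' => eqp.
    by apply/eqP; apply: (star_inj h's hs yv yh); rewrite eqp.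
  apply/subset_leq_card/subsetP => _ /imsetP[g /[!inE] /and4P[gE vg hg h'g] ->].
  have [] := ptP h g hs gE vg hg; have [] := ptP h' g h's gE vg h'g.
  by rewrite !inE /= => -> _ ->.
pose W := (e :\: cover P) :\ v.
have WP w : w \in W -> [/\ w \in e, w \notin cover P & w != v].
  by rewrite !inE => /and3P[].
have sGK : G \subset K.
  apply/subsetP => g; rewrite !inE => /and4P[-> ge -> ->]; rewrite !andbT /=.
  by apply: contraL ge => vg; apply/meetP; exists v.
have sheetsK : \sum_(w in W) #|sheet p w| <= #|K :\: G|.
  apply: sum_card_disjoint => [w /WP[we wP wv]|w w' l /WP[we _ _] /WP[w'e _ _]].
    apply/subsetP => l lp; have [ls _] := sheetP _ _ _ lp.
    have [lE wl _] := starP _ _ _ ls.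
    have lG : l \notin G.
      rewrite inE; apply/negP => /and4P[_ + _ _]; apply/negP/meetP.
      by exists w.
    rewrite !in_setD lG inE lE /= (sheet_meet ve we _ pP hp lp) 1?eq_sym //.
    rewrite (sheet_meet ve we _ pP h'p lp) 1?eq_sym // !andbT.
    by apply: contraNN wv => vl; rewrite (star_meet eE we ls ve vl).
  move=> /sheetP[ls _] /sheetP[/starP[_ wl' _] _].
  exact/esym/(star_meet eE we ls w'e wl').
have cardKG : #|G| + #|K :\: G| = #|K|.
  by rewrite -(cardsID G K) (setIidPr sGK).
have cardW : q <= #|W| + t.
  have := system_cover_base eE eP; have := cardsID (cover P) e.
  rewrite (E_uniform eE) (cardsD1 v (e :\: _)) inE ve vP /= -/W Pt.
  by clear; lia.
have deficitW : \sum_(w in W) q <= \sum_(w in W) #|sheet p w| + total_deficit.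
  apply: (@leq_trans (\sum_(w in W) (#|sheet p w| + deficit w))).
    by apply: leq_sum => w /WP[we wP _]; apply: sheet_lower.
  rewrite big_split /= leq_add2l /total_deficit.
  rewrite [leqRHS]big_mkcond [leqLHS]big_mkcond.
  by apply: leq_sum => w _; case: ifP => // /WP[-> _ _].
rewrite sum_nat_const in deficitW.
move: #|G| #|K| #|W| #|K :\: G| (\sum_(w in W) _) total_deficit
  cardK cardKG cardW deficitW sheetsK.
move=> G0 K0 W0 KG0 S0 D0 + + + + +; clear; nia.
Qed.

(** Edges missing [e] that block almost [q] of its petals at [v]. *)
Definition crossing v := [set g in E | [disjoint g & e] &&
  (q <= #|meeting e v g| + deficit v)].

Definition sheet_hits v p g := #|sheet p v :&: meeting e v g|.

Definition sheet_pairs v p g :=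
  [set hh in setX (sheet p v) (sheet p v) |
    [&& hh.1 != hh.2, ~~ [disjoint hh.1 & g] & ~~ [disjoint hh.2 & g]]].

Lemma card_sheet_pairs v p g :
  sheet_hits v p g * sheet_hits v p g <=
    #|sheet_pairs v p g| + sheet_hits v p g.
Proof.
rewrite /sheet_hits; set A := _ :&: _; rewrite -cardsX.
have -> : #|A| = #|[set (h, h) | h in A]| by rewrite card_imset // => h h' [].
apply: leq_trans (leq_card_setU _ _); apply/subset_leq_card/subsetP => -[h h'].
rewrite inE => /andP[/= hA h'A]; case: (eqVneq h h') => [<-|hh'].
  by rewrite inE; apply/orP; right; apply/imsetP; exists h.
rewrite !inE hh' /=; move: hA h'A; rewrite !inE.
by move=> /and3P[-> _ ->] /and3P[-> _ ->].
Qed.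

Lemma sum_sheet_pairs v p : v \in e -> v \notin cover P -> p \in P ->
  \sum_(g in crossing v) #|sheet_pairs v p g| <=
    q * q * (t * q + total_deficit).
Proof.
move=> ve vP pP; rewrite sum_card_sets.
apply: (@leq_trans (\sum_(hh in setX (sheet p v) (sheet p v))
                      (t * q + total_deficit))); last first.
  by rewrite sum_nat_const cardsX leq_mul2r leq_mul ?orbT ?sheet_upper.
rewrite [leqRHS]big_mkcond leq_sum // => -[h h'] _; case: ifPn => [|hh'].
  rewrite inE => /andP[/= hp h'p]; case: (eqVneq h h') => [<-|hh'].
    rewrite (_ : [set g in _ | _] = finset.set0) ?cards0 //.
    by apply/setP => g; rewrite !inE /= eqxx !andbF.
  apply: leq_trans (card_outer_transversals ve vP pP hp h'p hh').
  apply/subset_leq_card/subsetP => g; rewrite !inE /=.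
  by case/andP=> /and3P[-> -> _] /and4P[_ _ -> ->].
rewrite leqn0 cards_eq0; apply/eqP/setP => g; rewrite in_set0.
by apply: contraNF hh' => /setIdP[_ /setIdP[]].
Qed.

(** At most [t * deficit v] petals at [v] lie outside all sheets, so nearly all
those met by a crossing edge lie in a sheet. *)
Lemma sum_sheet_hits v g : v \in e -> v \notin cover P ->
  2 * (t + 1) * deficit v <= q -> g \in crossing v ->
  q <= 2 * \sum_(p in P) sheet_hits v p g.
Proof.
move=> ve vP small; rewrite inE => /and3P[gE ge many].
pose S := \bigcup_(p in P) sheet p v.
have cardS : \sum_(p in P) #|sheet p v| <= #|S|.
  apply: sum_card_disjoint => [p pP|p r h pP rP].
    by apply/subsetP => h hp; apply/bigcupP; exists p.
  exact: sheet_disjoint.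
have lower : t * q <= \sum_(p in P) #|sheet p v| + t * deficit v.
  rewrite -Pt -2!sum_nat_const -big_split leq_sum // => p pP.
  exact: sheet_lower.
have sS : S \subset star e v.
  by apply/bigcupsP => p pP; apply/subsetP => h /sheetP[].
have rest : #|star e v :\: S| <= t * deficit v.
  have := cardsID S (star e v); rewrite (setIidPr sS).
  move: (deficitK ve) lower cardS.
  by clear; lia.
have : #|meeting e v g| <= \sum_(p in P) sheet_hits v p g + #|star e v :\: S|.
  rewrite -(cardsID S) leq_add //; last first.
    by apply/subset_leq_card/setSD/subsetP => h; rewrite inE => /andP[].
  apply: leq_trans (leq_card_bigcup _ _).
  by rewrite setIC /S big_distrl.
by move: many small rest; clear; nia.
Qed.

(** Double counting of the triples [(g, h, h')] with [g] crossing and [h], [h']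
distinct members of one sheet at [v] that [g] meets: there are at most
[t * (q * q) * (t * q + total_deficit)] of them, while a crossing edge takes
part in at least [q * q / (8 * t)] by convexity. *)
Lemma card_crossing v : v \in e -> v \notin cover P -> 4 * t <= q ->
  2 * (t + 1) * deficit v <= q ->
  #|crossing v| <= 8 * t ^ 2 * (t * q + total_deficit).
Proof.
move=> ve vP tq small.
have pairs g : g \in crossing v ->
    q * q <= 8 * t * \sum_(p in P) #|sheet_pairs v p g|.
  move=> /(sum_sheet_hits ve vP small).
  set M := \sum_(p in P) _; set S := \sum_(p in P) _ => qM.
  have : \sum_(p in P) (4 * t * q * sheet_hits v p g) <=
      \sum_(p in P) (4 * t * t * (#|sheet_pairs v p g| + sheet_hits v p g) + q * q).
    apply: leq_sum => p _; have := card_sheet_pairs v p g.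
    move: #|sheet_pairs v p g| (sheet_hits v p g) => s m sm.
    (* The tangent to the square at the average number [q / (2 * t)] of hits
       per sheet: [(2 * t * m - q) ^ 2 >= 0]. *)
    apply: (@leq_trans (4 * t * t * (m * m) + q * q)).
      by have [+ _] := nat_Cauchy (2 * t * m) q; rewrite -!mulnn; clear; lia.
    by rewrite leq_add2r leq_mul2l sm orbT.
  rewrite -big_distrr big_split -big_distrr big_split /= -/M -/S.
  rewrite sum_nat_const Pt; move: t_gt0 tq qM; clear.
  move: M S => M S t0 tq qM H.
  have {}H : 4 * q * M <= 4 * t * (S + M) + q * q.
    by rewrite -(leq_pmul2r t0); move: H; clear; lia.
  by move: qM H tq; clear; nia.
have : #|crossing v| * (q * q) <=
    8 * t * (t * (q * q * (t * q + total_deficit))).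
  rewrite -sum_nat_const.
  apply: (@leq_trans (\sum_(g in crossing v)
                        8 * t * \sum_(p in P) #|sheet_pairs v p g|)).
    exact: leq_sum.
  rewrite -big_distrr leq_mul2l exchange_big -[t in t * (_ * _)]Pt -sum_nat_const.
  by apply/orP; right; apply: leq_sum => p pP; apply: sum_sheet_pairs.
have q0 : 0 < q * q by rewrite muln_gt0 andbb; move: tq t_gt0; clear; lia.
move=> bound; rewrite -(leq_pmul2r q0) -mulnn.
by move: total_deficit bound; clear; lia.
Qed.

(** A flag is a pair [(x, g)] with [g] crossing and [x] in [g].  An edge [g] at
a vertex [x] of [f] that misses [e] is crossing by [last_petal] for the base [f];
at most [q] edges at [x] meet [e].  A vertex [x] off [e] lies on only one petal
at [v], so the flags of different petals are different. *)
Lemma sum_crossing_flags v (F : {set {set V}}) (X : {set V} -> {set V}) :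
  v \in e -> F \subset star e v ->
  (forall f, f \in F -> [/\ X f \subset f :\ v, t <= #|X f|
     & forall x, x \in X f -> (t - 1) * q < #|star f x|]) ->
  \sum_(f in F) \sum_(x in X f) (#|star f x| - q) <= (q + 1) * #|crossing v|.
Proof.
move=> ve sF FX.
have flag f x : f \in F -> x \in X f ->
    #|star f x| - q <= #|[set g in crossing v | x \in g]|.
  move=> fF xX; have [sX tX highX] := FX f fF.
  have /starP[fE vf fe] := subsetP sF f fF.
  have xf := subsetP sX x xX; have /setD1P[xv xf'] := xf.
  have xe : x \notin e.
    by apply: contraNN xv => xe; rewrite (star_meet eE ve (subsetP sF f fF) xe).
  rewrite leq_subLR -(cardsID (meeting f x e)) leq_add //.
    apply: leq_trans (_ : #|meeting f x e| <= q).
      by rewrite subset_leq_card ?subsetIr.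
    by apply: leq_card_meeting => //; apply/meetP; exists v.
  apply/subset_leq_card/subsetP => g /setDP[gs].
  rewrite /meeting in_set gs /= negbK => ge; have [gE xg gf] := starP _ _ _ gs.
  rewrite !inE gE ge xg andbT /=.
  have := last_petal t_gt0 fE vf sX highX tX xf gs.
  have := hdeg_star fE vf; rewrite (hdeg_star eE ve) => -[<-].
  have : #|meeting f v g| <= #|meeting e v g|.
    apply/subset_leq_card/subsetP => h; rewrite !inE.
    move=> /andP[/and3P[-> -> hf] hg]; rewrite hg /= andbT.
    by apply: contraNneq hg => ->; rewrite disjoint_sym.
  have -> : (t - 1) * q = t * q - q by rewrite mulnBl mul1n.
  have := deficitK ve; have := leq_pmull q t_gt0; clear.
  by move: #|star e v| (deficit v) #|meeting e v g| #|meeting f v g| => s d m m'; lia.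
apply: (@leq_trans (\sum_(f in F) \sum_(x in X f)
                       #|[set g in crossing v | x \in g]|)).
  by apply: leq_sum => f fF; apply: leq_sum => x; apply: flag.
have -> : \sum_(f in F) \sum_(x in X f) #|[set g in crossing v | x \in g]| =
    \sum_(g in crossing v) \sum_(f in F) #|X f :&: g|.
  rewrite [RHS]exchange_big /=; apply: eq_bigr => f fF.
  rewrite [RHS]sum_card_sets [LHS]big_mkcond /=; apply: eq_bigr => x _.
  case: ifPn => xX.
    by apply: eq_card => g; rewrite !in_set xX.
  apply/esym/eqP; rewrite cards_eq0; apply/eqP/setP => g.
  by rewrite !in_set (negbTE xX) andbF.
rewrite mulnC -sum_nat_const leq_sum // => g; rewrite inE => /andP[gE _].
rewrite -(E_uniform gE); apply: sum_card_disjoint => [f _|f f' x fF f'F].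
  exact: subsetIr.
have [sX _ _] := FX f fF; have [sX' _ _] := FX f' f'F.
move=> /setIP[/(subsetP sX)/setD1P[xv xf] _].
move=> /setIP[/(subsetP sX')/setD1P[_ xf'] _].
exact: (star_inj (subsetP sF _ f'F) (subsetP sF _ fF) xv).
Qed.

End BaseEdge.
End CrownFree.
End Hypergraph.

Import Order.TTheory GRing.Theory Num.Theory.
Local Open Scope ring_scope.

(** * Numerical estimates *)

(** To leading order the two sides are [1 / T + theta / T ^ 2] and
[1 / (T - 1 + c) >= 1 / T + (1 - c) / T ^ 2].  With [c = (1 - theta) / 4] the
gap [1 - c - theta = 3 * c] absorbs the loss [c / T ^ 2] from the exceptional
[c * Q / T] vertices and the errors of order [1 / Q <= c / T ^ 2]. *)
Lemma small_degrees_ineq (R : realFieldType) (T Q theta c : R) :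
  2 <= T -> 0 < theta -> theta < 1 -> c = (1 - theta) / 4 ->
  T ^+ 2 <= c * Q ->
  theta / T ^+ 2 + (Q + 1) / (T * Q + 1) <=
    (Q - c * Q / T) / ((T - 1 + c) * Q + 1).
Proof.
move=> t2 theta0 theta1 c_gap t2_small.
have {c_gap} c_gap : theta = 1 - 4 * c by rewrite c_gap; field.
have c0 : 0 < c by lra.
have c4 : c < 1 / 4 by lra.
have TQ : 4 * T < Q by nra.
have a0 : 0 < (T - 1 + c) * Q + 1 by rewrite ltr_wpDl // mulr_ge0; lra.
have TQ0 : 0 < T * Q by rewrite mulr_gt0; lra.
rewrite ler_pdivlMr //.
apply: (@le_trans _ _
  ((theta / T ^+ 2 + (Q + 1) / (T * Q)) * ((T - 1 + c) * Q + 1))).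
  rewrite ler_pM2r // lerD2l ler_pM2l; last by lra.
  by rewrite lef_pV2 ?posrE; lra.
have -> : theta / T ^+ 2 + (Q + 1) / (T * Q) =
    (theta * Q + (Q + 1) * T) / (T ^+ 2 * Q) by field; lra.
have -> : Q - c * Q / T = (Q ^+ 2 * (T ^+ 2 - c * T)) / (T ^+ 2 * Q) by field; lra.
rewrite mulrAC ler_pM2r; last by rewrite invr_gt0 mulr_gt0 ?exprn_gt0; lra.
have cTQ0 : 0 <= c * T * Q by rewrite !mulr_ge0; lra.
have H1 : T ^+ 2 * Q <= c * Q ^+ 2.
  by rewrite (_ : c * Q ^+ 2 = c * Q * Q); [rewrite ler_pM2r; lra|ring].
have H2 : 2 * (c * Q ^+ 2) <= c * T * Q ^+ 2.
  rewrite (_ : c * T * Q ^+ 2 = T * (c * Q ^+ 2)); last by ring.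
  by rewrite ler_wpM2r ?mulr_ge0 ?exprn_ge0; lra.
have H3 : 8 * (c * T * Q) <= c * T * Q ^+ 2.
  rewrite (_ : c * T * Q ^+ 2 = Q * (c * T * Q)); last by ring.
  by rewrite ler_wpM2r; lra.
have H4 : 2 * T <= T ^+ 2 by rewrite expr2 ler_pM2r; lra.
have H5 : 2 * (c * Q) <= c * T * Q.
  rewrite (_ : c * T * Q = T * (c * Q)); last by ring.
  by rewrite ler_wpM2r ?mulr_ge0; lra.
have H6 : 0 <= theta * Q * ((1 - c) * Q - 1).
  apply: mulr_ge0; first by rewrite mulr_ge0; lra.
  have -> : (1 - c) * Q - 1 = (3 / 4 - c) * Q + (Q / 4 - 1) by field.
  by rewrite addr_ge0 ?mulr_ge0; lra.
rewrite -subr_ge0.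
have -> : Q ^+ 2 * (T ^+ 2 - c * T) -
    (theta * Q + (Q + 1) * T) * ((T - 1 + c) * Q + 1) =
  2 * (c * T * Q ^+ 2) - T ^+ 2 * Q - c * T * Q - T
    + theta * Q * ((1 - c) * Q - 1) by rewrite c_gap; ring.
lra.
Qed.

Lemma sum_low_ineq (R : realFieldType) (K D T Q : R) :
  2 <= T -> T <= Q -> 0 < Q -> K <= T -> 0 <= D ->
  (Q + 1) * (32 * T ^+ 2 * (T * Q + D)) + K * (T * Q ^+ 2) +
    4 * T ^+ 2 * Q * D <= Q * (69 * T ^+ 2 * (T * Q + D)).
Proof.
move=> T2 TQ Q0 KT D0.
have TQ2 : 0 <= T * Q ^+ 2 by rewrite mulr_ge0 ?exprn_ge0; lra.
have H1 : K * (T * Q ^+ 2) <= T * (T * Q ^+ 2) by rewrite ler_wpM2r.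
have H2 : 2 * (T * (T * Q ^+ 2)) <= T * (T * (T * Q ^+ 2)).
  by rewrite ler_wpM2r // mulr_ge0; lra.
have TQD : 0 <= T ^+ 2 * (T * Q + D).
  by rewrite mulr_ge0 ?sqr_ge0 // addr_ge0 // mulr_ge0; lra.
have H3 : 1 * (T ^+ 2 * (T * Q + D)) <= Q * (T ^+ 2 * (T * Q + D)).
  by rewrite ler_wpM2r //; lra.
have H4 : 0 <= T ^+ 2 * Q * D by rewrite !mulr_ge0 ?sqr_ge0 //; lra.
have H5 : 0 <= T * (T * (T * Q ^+ 2)).
  by do 2! (rewrite mulr_ge0 //; first by lra); rewrite mulr_ge0; lra.
lra.
Qed.

Lemma ratio_ineq (R : realFieldType) (c L D S T Q d : R) :
  0 < c -> c < 1 -> 2 <= T -> 0 < Q -> 0 <= D ->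
  D <= 4 * T ^+ 2 * Q ^+ 2 * d ->
  c ^+ 2 * L <= 69 * T ^+ 2 * (T * Q + D) ->
  (Q + 1) * (T * Q) <= S + L + D ->
  (1 - 70 / c ^+ 2 * (T ^+ 2 / Q + 4 * (T ^+ 3 * d))) * ((Q + 1) * (T * Q)) <= S.
Proof.
move=> c0 c1 T2 Q0 D0 Dd cL WS.
have T0 : 0 < T by lra.
have c20 : 0 < c ^+ 2 by rewrite exprn_gt0.
have d0 : 0 <= d.
  rewrite -(pmulr_rge0 _ (_ : 0 < 4 * T ^+ 2 * Q ^+ 2)) ?(le_trans D0) //.
  by rewrite !mulr_gt0 ?exprn_gt0.
have TD : T ^+ 2 * D <= T ^+ 2 * (4 * T ^+ 2 * Q ^+ 2 * d).
  by rewrite ler_wpM2l ?sqr_ge0.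
set Y := T ^+ 2 / Q + 4 * (T ^+ 3 * d).
have Y0 : 0 <= Y.
  apply: addr_ge0; first by rewrite divr_ge0 ?sqr_ge0 ?ltW.
  by rewrite !mulr_ge0 ?exprn_ge0 // ltW.
have YW : T ^+ 2 * (T * Q + D) <= Y * (T * Q ^+ 2).
  have -> : Y * (T * Q ^+ 2) = T ^+ 2 * (T * Q) + T ^+ 2 * (4 * T ^+ 2 * Q ^+ 2 * d).
    by rewrite /Y; field; lra.
  by rewrite mulrDr lerD2l.
have TQD : D <= T ^+ 2 * (T * Q + D).
  have H : 1 * D <= T ^+ 2 * D by rewrite ler_wpM2r // expr2; nra.
  have H' : 0 <= T ^+ 2 * (T * Q) by rewrite !mulr_ge0 ?sqr_ge0 ?ltW.
  by rewrite mulrDr; lra.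
have LD : c ^+ 2 * (L + D) <= 70 * (Y * (T * Q ^+ 2)).
  have H : c ^+ 2 * D <= 1 * D by rewrite ler_wpM2r // expr2; nra.
  by rewrite mulrDr; lra.
have {LD} LD : L + D <= 70 / c ^+ 2 * (Y * (T * Q ^+ 2)).
  by rewrite mulrAC ler_pdivlMr // mulrC.
have grow : 70 / c ^+ 2 * (Y * (T * Q ^+ 2)) <=
    70 / c ^+ 2 * Y * ((Q + 1) * (T * Q)).
  rewrite -[leRHS]mulrA ler_wpM2l ?mulr_ge0 ?invr_ge0 ?sqr_ge0 // ler_wpM2l //.
  by rewrite -subr_ge0 (_ : _ - _ = T * Q); [rewrite mulr_ge0 ?ltW|ring].
rewrite mulrBl mul1r; lra.
Qed.

(** * Defect and degrees *)

Section Defect.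
Variables (R : realType) (V : finType) (E : {set {set V}}) (q t : nat).
Variables (theta c : R).
Hypothesis E_uniform : uniform (q + 1) E.
Hypothesis E_linear : linear_hypergraph E.
Hypothesis E_crown_free : crown_free (t + 1) E.
Hypotheses (t_ge2 : (2 <= t)%N) (t_leq : (t <= q)%N).
Hypotheses (theta_gt0 : 0 < theta) (theta_lt1 : theta < 1).
Hypotheses (c_gap : c = (1 - theta) / 4) (t2_small : t%:R ^+ 2 <= c * q%:R).
Implicit Types (f g : {set V}) (v x : V).

Local Notation star := (star E).
Local Notation defect := (defect R q t E).

Definition high f v := [set x in f :\ v |
  (t%:R - 1 + c) * q%:R < #|star f x|%:R].

Let t2 : 2 <= t%:R :> R. Proof. by rewrite (ler_nat _ 2). Qed.
Let tq : t%:R <= q%:R :> R. Proof. by rewrite ler_nat. Qed.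
Let c_gt0 : 0 < c. Proof. by move: c_gap theta_lt1 => *; lra. Qed.
Let c_lt : c < 1 / 4. Proof. by move: c_gap theta_gt0 => *; lra. Qed.
Let q_gt0 : 0 < q%:R :> R.
Proof. by apply: lt_le_trans tq; apply: lt_le_trans t2. Qed.

(** The at least [q - c * q / t] remaining vertices have degree at most
[(t - 1 + c) * q + 1]. *)
Lemma few_high_defect f v : f \in E -> v \in f ->
  #|high f v|%:R * t%:R <= c * q%:R -> theta / t%:R ^+ 2 <= defect f.
Proof.
move=> fE vf few; rewrite /Defs.defect lerBrDr.
rewrite !natrD natrM.
apply: le_trans (small_degrees_ineq t2 theta_gt0 theta_lt1 c_gap t2_small) _.
pose A := (f :\ v) :\: high f v.
have a1 : 0 < t%:R - 1 + c by move: t2 c_gt0 => *; lra.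
have a0 : 0 < (t%:R - 1 + c) * q%:R + 1 :> R.
  by rewrite ltr_wpDl // mulr_ge0 ?ltW.
have sA : A \subset f by rewrite /A !subDset subsetU // subsetU ?subxx ?orbT.
have cardA : q%:R - c * q%:R / t%:R <= #|A|%:R :> R.
  have fv : #|f :\ v| = q.
    by apply/esym/(@addnI 1); rewrite addnC -(E_uniform fE) (cardsD1 v) vf.
  have : q%:R <= #|high f v|%:R + #|A|%:R :> R.
    rewrite -natrD ler_nat -fv -(cardsID (high f v)) leq_add2r.
    by rewrite subset_leq_card ?subsetIr.
  have : #|high f v|%:R <= c * q%:R / t%:R :> R.
    by rewrite ler_pdivlMr // (lt_le_trans _ t2).
  by move=> *; lra.
apply: (@le_trans _ _ (\sum_(x in A) ((t%:R - 1 + c) * q%:R + 1)^-1)).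
  rewrite sumr_const -[leRHS]mulr_natl ler_pM2r ?invr_gt0 //.
rewrite [leLHS]big_mkcond [leRHS]big_mkcond ler_sum // => x _.
case: ifPn => [xA|_]; last by case: ifP; rewrite ?invr_ge0.
have xf := subsetP sA x xA; rewrite xf (hdeg_star fE xf).
rewrite lef_pV2 ?posrE // -natr1 lerD2r leNgt.
by apply: contraL xA => hx; rewrite !inE hx andbT; case: (x != v); rewrite ?xf.
Qed.

Lemma high_degree f v x : x \in high f v -> ((t - 1) * q < #|star f x|)%N.
Proof.
rewrite inE => /andP[_ hx]; rewrite -(ltr_nat R) natrM natrB ?(ltnW t_ge2) //.
by apply: le_lt_trans hx; rewrite ler_pM2r // lerDl ltW.
Qed.

Lemma high_sub f v : high f v \subset f :\ v.
Proof. by apply/subsetP => x /setIdP[]. Qed.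

Lemma many_high f v : f \in E -> v \in f -> defect f < theta / t%:R ^+ 2 ->
  c * q%:R < #|high f v|%:R * t%:R /\ (t <= #|high f v|)%N.
Proof.
move=> fE vf; rewrite ltNge => df.
have many : c * q%:R < #|high f v|%:R * t%:R.
  by rewrite ltNge; apply: contraNN df; apply: few_high_defect.
split=> //; rewrite -(ler_nat R) ltW //.
by have := le_lt_trans t2_small many; rewrite expr2 ltr_pM2r // (lt_le_trans _ t2).
Qed.

(** * The petals of an edge of small defect *)

Section Base.
Variables (e : {set V}).
Hypotheses (eE : e \in E) (e_defect : defect e < theta / t%:R ^+ 2).

Local Notation deficit := (deficit E q t e).
Local Notation total_deficit := (total_deficit E q t e).

Let t_gt0 : (0 < t)%N. Proof. exact: ltnW. Qed.

Lemma base_degree v : v \in e -> (#|star e v| <= t * q)%N.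
Proof.
move=> ve; have [_ tX] := many_high eE ve e_defect.
apply: (high_points_degree E_uniform E_linear E_crown_free t_gt0 eE ve
  (high_sub e v)) => //.
by move=> x; apply: high_degree.
Qed.

(** With [d = D - deficit v], each term [1 / d - 1 / D] of the defect is at
least [deficit v / D ^ 2]. *)
Lemma total_deficit_defect :
  total_deficit%:R <= 4 * t%:R ^+ 2 * q%:R ^+ 2 * defect e.
Proof.
have D0 : 0 < (t * q + 1)%:R :> R by rewrite ltr0n addn1.
have bound : total_deficit%:R / (t * q + 1)%:R ^+ 2 <= defect e.
  rewrite /Defs.defect lerBrDr.
  have -> : (q + 1)%:R / (t * q + 1)%:R = \sum_(v in e) (t * q + 1)%:R^-1 :> R.
    by rewrite sumr_const (E_uniform eE) -[RHS]mulr_natl.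
  rewrite natr_sum mulr_suml -big_split /=.
  apply: ler_sum => v ve; rewrite (hdeg_star eE ve).
  rewrite -(deficitK base_degree ve) -[#|star e v|.+1]addn1 !natrD.
  have : 0 <= #|star e v|%:R :> R by [].
  have : 0 <= (deficit v)%:R :> R by [].
  move: #|star e v|%:R (deficit v)%:R => x y y0 x0.
  rewrite -subr_ge0.
  have -> : (x + 1)^-1 - (y / (x + y + 1) ^+ 2 + (x + y + 1)^-1) =
    y ^+ 2 / ((x + 1) * (x + y + 1) ^+ 2) by field; lra.
  by rewrite divr_ge0 ?sqr_ge0 // mulr_ge0 ?sqr_ge0 //; lra.
have d0 : 0 <= defect e by apply: le_trans bound; rewrite divr_ge0 ?sqr_ge0.
move: bound; rewrite ler_pdivrMr ?exprn_gt0 // => /le_trans; apply.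
rewrite mulrC ler_wpM2r // (_ : 4 * _ * _ = (2 * t%:R * q%:R) ^+ 2); last by ring.
rewrite ler_sqr ?nnegrE ?mulr_ge0 //.
rewrite -!natrM ler_nat -mulnA mul2n -addnn leq_add2l muln_gt0 t_gt0.
exact: leq_trans t_leq.
Qed.

Definition low v := [set f in star e v | defect f < theta / t%:R ^+ 2].

(** There are more than [c * q / t] high vertices on [f], and beyond the [q]
edges that may meet [e] each has [(t - 2 + c) * q >= c * t * q / 2] others. *)
Lemma low_flags v f : v \in e -> f \in low v ->
  (c * q%:R) ^+ 2 / 2 <=
    (\sum_(x in high f v) (#|star f x| - q)%N)%:R :> R.
Proof.
move=> ve /setIdP[/starP[fE vf _] df].
have [many _] := many_high fE vf df.
have each x : x \in high f v -> c * t%:R * q%:R / 2 <= (#|star f x| - q)%:R :> R.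
  move=> xh; have := xh; rewrite inE => /andP[_ hx].
  have qs : (q <= #|star f x|)%N.
    apply: leq_trans (high_degree xh); apply: leqW.
    by rewrite leq_pmull // subn_gt0.
  rewrite natrB //.
  have : c * t%:R * q%:R / 2 + q%:R <= (t%:R - 1 + c) * q%:R.
    rewrite -subr_ge0.
    have -> : (t%:R - 1 + c) * q%:R - (c * t%:R * q%:R / 2 + q%:R) =
      (t%:R - 2) * (1 - c / 2) * q%:R by field.
    by move: t2 c_lt q_gt0 => *; rewrite !mulr_ge0; lra.
  by move: hx => + ?; lra.
rewrite natr_sum; apply: le_trans (ler_sum _ each).
rewrite sumr_const -[leRHS]mulr_natl.
have -> : #|high f v|%:R * (c * t%:R * q%:R / 2) =
  #|high f v|%:R * t%:R * (c * q%:R) / 2 by ring.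
by rewrite ler_pM2r ?invr_gt0 // expr2 ler_pM2r ?mulr_gt0 // ltW.
Qed.

Section System.
Variable P : {set {set V}}.
Hypotheses (eP : petal_system E e P) (Pt : #|P| = t).

(** The main term comes from counting flags.  It needs [v] off the reference
system and of small deficit; at other vertices the trivial bound [t * q] is
absorbed by the last two terms, which are small in sum over [e]. *)
Lemma low_bound v : v \in e ->
  c ^+ 2 * q%:R * #|low v|%:R <=
    32 * t%:R ^+ 2 * (t * q + total_deficit)%:R
    + (v \in cover P)%:R * (t%:R * q%:R ^+ 2)
    + 4 * t%:R ^+ 2 * q%:R * (deficit v)%:R.
Proof.
move=> ve.
have low_le : c ^+ 2 * q%:R * #|low v|%:R <= t%:R * q%:R ^+ 2.
  have : #|low v|%:R <= t%:R * q%:R :> R.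
    rewrite -natrM ler_nat (leq_trans _ (base_degree ve)) // subset_leq_card //.
    by apply/subsetP => f /setIdP[].
  move=> lowtq.
  have -> : t%:R * q%:R ^+ 2 = q%:R * (t%:R * q%:R) :> R by ring.
  rewrite -mulrA; apply: le_trans (_ : q%:R * #|low v|%:R <= _).
    by rewrite ler_piMl ?mulr_ge0 // exprn_ile1 ?ltW //; move: c_lt => *; lra.
  by rewrite ler_pM2l.
have main0 : 0 <= 32 * t%:R ^+ 2 * (t * q + total_deficit)%:R :> R.
  by rewrite !mulr_ge0 ?exprn_ge0.
have def0 : 0 <= 4 * t%:R ^+ 2 * q%:R * (deficit v)%:R :> R.
  by rewrite !mulr_ge0 ?exprn_ge0.
have [vP|vP] := boolP (v \in cover P); first by move=> *; rewrite mul1r; lra.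
rewrite mul0r addr0; have [small|big] := leqP (2 * (t + 1) * deficit v) q; last first.
  suff : t%:R * q%:R ^+ 2 <= 4 * t%:R ^+ 2 * q%:R * (deficit v)%:R :> R by lra.
  rewrite -!(natrM, natrX) ler_nat.
  apply: leq_trans (_ : t * q * (2 * (t + 1) * deficit v) <= _)%N.
    by rewrite expnS expn1 mulnA leq_mul2l ltnW ?orbT.
  by move: t_ge2; clear; nia.
suff : c ^+ 2 * q%:R * #|low v|%:R <=
  32 * t%:R ^+ 2 * (t * q + total_deficit)%:R by lra.
have tq4 : (4 * t <= q)%N.
  rewrite -(ler_nat R) natrM; move: t2 t2_small c_lt q_gt0.
  by move: t%:R q%:R => T Q *; nra.
have flags := sum_crossing_flags E_uniform E_linear E_crown_free t_gt0 eE
  base_degree (F := low v) (X := fun f => high f v) ve.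
have /flags {}flags : low v \subset star e v by apply/subsetP => f /setIdP[].
have := leq_trans (flags _) (leq_mul (leqnn _)
  (card_crossing E_uniform E_linear E_crown_free t_gt0 eE eP Pt base_degree
     ve vP tq4 small)).
move=> {}flags.
have {}flags : (\sum_(f in low v) \sum_(x in high f v) (#|star f x| - q) <=
    (q + 1) * (8 * t ^ 2 * (t * q + total_deficit)))%N.
  apply: flags => f /setIdP[/starP[fE vf _] df]; split.
  - exact: high_sub.
  - by have [] := many_high fE vf df.
  - by move=> x; apply: high_degree.
have q0 : 0 < q%:R / 2 :> R by rewrite divr_gt0.
rewrite -(ler_pM2r q0).
apply: le_trans (_ : ((q + 1) * (8 * t ^ 2 * (t * q + total_deficit)))%:R <= _).
  apply: le_trans (_ :
    (\sum_(f in low v) \sum_(x in high f v) (#|star f x| - q))%:R <= _).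
    rewrite natr_sum.
    apply: le_trans (_ : \sum_(f in low v) (c * q%:R) ^+ 2 / 2 <= _).
      rewrite sumr_const -[leRHS]mulr_natl le_eqVlt; apply/orP; left.
      by apply/eqP; field.
    by apply: ler_sum => f; apply: low_flags.
  by rewrite ler_nat.
rewrite natrM [(8 * _ * _)%:R]natrM [(8 * _)%:R]natrM natrX.
have -> : 32 * t%:R ^+ 2 * (t * q + total_deficit)%:R * (q%:R / 2) =
  2 * q%:R * (8 * t%:R ^+ 2 * (t * q + total_deficit)%:R) :> R by field.
rewrite ler_wpM2r ?mulr_ge0 ?exprn_ge0 //.
by rewrite -natrM ler_nat mul2n -addnn leq_add2l (leq_trans t_gt0).
Qed.

End System.

Lemma sum_low :
  c ^+ 2 * (\sum_(v in e) #|low v|)%:R <=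
    69 * t%:R ^+ 2 * (t * q + total_deficit)%:R.
Proof.
have /card_gt0P[v ve] : (0 < #|e|)%N by rewrite (E_uniform eE) addn1.
have [P [_ eP _ Pt]] : exists P : {set {set V}},
    [/\ finset.set0 \subset P, petal_system E e P, v \notin cover P
      & #|P| = t].
  have [_ tX] := many_high eE ve e_defect.
  apply: (system_extend E_uniform E_linear E_crown_free eE ve _ _
    (high_sub e v)) => //.
  - by split=> [|p|p p']; rewrite ?sub0set ?inE.
  - by rewrite /cover big_set0 inE.
  - by move=> x; apply: high_degree.
rewrite -(ler_pM2l q_gt0).
have -> : q%:R * (c ^+ 2 * (\sum_(v in e) #|low v|)%:R) =
    \sum_(v in e) c ^+ 2 * q%:R * #|low v|%:R.
  by rewrite -mulr_sumr natr_sum; ring.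
apply: le_trans (ler_sum _ (low_bound eP Pt)) _.
rewrite 2!big_split /= sumr_const (E_uniform eE).
rewrite -mulr_suml -mulr_sumr -natr_sum -natr_sum.
rewrite -/total_deficit -[_ *+ (q + 1)]mulr_natl.
have cov : (\sum_(v in e) (v \in cover P) <= t)%N.
  rewrite -Pt; apply: leq_trans (system_cover_base E_linear eE eP).
  rewrite -sum1_card [leqRHS]big_mkcond [leqLHS]big_mkcond /= leq_sum // => x _.
  by rewrite inE; case: (x \in e) => //=; case: (x \in _).
have {}cov : (\sum_(v in e) (v \in cover P))%:R <= t%:R :> R by rewrite ler_nat.
rewrite [(q + 1)%:R]natrD [(t * q + _)%:R]natrD natrM.
have : 0 <= total_deficit%:R :> R by [].
move: t2 tq q_gt0 cov; move: (\sum_(v in e) _)%:R total_deficit%:R t%:R q%:R.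
move=> K D T Q t2' tq' q0 KT D0.
exact: sum_low_ineq.
Qed.

Definition large := [set f in E | [&& f != e, f :&: e != finset.set0 &
  theta / t%:R ^+ 2 <= defect f]].

Lemma large_leq : (#|large| <= (q + 1) * (t * q))%N.
Proof.
apply: (@leq_trans (\sum_(v in e) #|star e v|)).
  apply: leq_trans (leq_card_bigcup _ _); apply/subset_leq_card/subsetP => f.
  rewrite inE => /and4P[fE fe /set0Pn[v /setIP[vf ve]] _].
  by apply/bigcupP; exists v => //; apply/starP.
by rewrite -(E_uniform eE) -sum_nat_const leq_sum // => v; apply: base_degree.
Qed.

(** The petals of [e] number [(q + 1) * (t * q)] minus the total deficit, and
each of them is either large or low at its vertex on [e]. *)
Lemma large_geq : ((q + 1) * (t * q) <=
  #|large| + \sum_(v in e) #|low v| + total_deficit)%N.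
Proof.
have -> : ((q + 1) * (t * q) =
    \sum_(v in e) (#|star e v :\: low v| + #|low v| + deficit v))%N.
  rewrite -(E_uniform eE) -sum_nat_const; apply: eq_bigr => v ve.
  rewrite -(deficitK base_degree ve) -(cardsID (low v) (star e v)); congr (_ + _)%N.
  by rewrite addnC (setIidPr _) //; apply/subsetP => f /setIdP[].
rewrite 2!big_split /= 2!leq_add2r.
apply: sum_card_disjoint => [v ve|v w f ve we /setDP[fs _] /setDP[/starP[_ wf _] _]].
  apply/subsetP => f /setDP[fs]; rewrite /low in_set fs /= -leNgt => df.
  have [fE vf fe] := starP _ _ _ _ fs.
  rewrite inE fE fe df andbT; apply/set0Pn; exists v.
  by rewrite inE vf.
by rewrite (star_meet E_linear eE ve fs we wf).
Qed.

Lemma large_ratio :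
  1 - 70 / c ^+ 2 * (t%:R ^+ 2 / q%:R + 4 * (t%:R ^+ 3 * defect e)) <=
    #|large|%:R / ((q + 1)%:R * ((t * q + 1)%:R - 1)) <= (1 : R).
Proof.
have -> : (q + 1)%:R * ((t * q + 1)%:R - 1) = ((q + 1) * (t * q))%:R :> R.
  by rewrite natrM [(_ + 1)%:R in X in _ * X = _]natrD addrK.
have W0 : 0 < ((q + 1) * (t * q))%:R :> R.
  by rewrite ltr0n !muln_gt0 addn1 t_gt0 (leq_trans t_gt0 t_leq).
rewrite ler_pdivrMr // ler_pdivlMr // mul1r ler_nat large_leq andbT.
have := large_geq; rewrite -(ler_nat R) !natrD.
have := sum_low; have := total_deficit_defect.
have : 0 <= total_deficit%:R :> R by [].
rewrite [(t * q + total_deficit)%:R]natrD !natrM [(q + 1)%:R]natrD => D0 Dd cL WS.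
by apply: ratio_ineq WS; rewrite // (lt_trans c_lt) //; lra.
Qed.

End Base.
End Defect.

Import numFieldNormedType.Exports.

Local Open Scope classical_set_scope.
Local Open Scope ring_scope.

Theorem theorem9p1 (R : realType) (q t : nat -> nat)
    (V : nat -> finType) (E : forall j : nat, {set {set V j}})
    (e : forall j : nat, {set V j})
    (q_oo : (q j)%:R @[j --> \oo] --> (+oo : set_system R))
    (t_bounds : forall j : nat, (2 <= t j)%N /\ (t j <= q j)%N)
    (E_uniform : forall j : nat, uniform (q j + 1) (E j))
    (E_linear : forall j : nat, linear_hypergraph (E j))
    (E_crown_free : forall j : nat, crown_free (t j + 1) (E j))
    (e_edge : forall j : nat, e j \in E j)
    (t2q_0 : ((t j)%:R ^+ 2 / (q j)%:R : R) @[j --> \oo] --> (0 : R))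
    (t3defect_0 : ((t j)%:R ^+ 3 * defect R (q j) (t j) (E j) (e j))
                    @[j --> \oo] --> (0 : R))
    (theta : R) (theta_gt0 : 0 < theta) (theta_lt1 : theta < 1) :
  (#|[set f in E j | [&& f != e j, f :&: e j != finset.set0 &
        theta / (t j)%:R ^+ 2 <= defect R (q j) (t j) (E j) f]]|%:R
     / ((q j + 1)%:R * ((t j * q j + 1)%:R - 1)) : R)
    @[j --> \oo] --> (1 : R).
Proof.
pose c : R := (1 - theta) / 4.
have c_gt0 : 0 < c by rewrite divr_gt0 ?subr_gt0.
pose error j : R := (t j)%:R ^+ 2 / (q j)%:R +
  4 * ((t j)%:R ^+ 3 * defect R (q j) (t j) (E j) (e j)).
apply: (@squeeze_cvgr _ _ _ _ (fun j => 1 - 70 / c ^+ 2 * error j) (fun=> 1)).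
- near=> j; have [t_ge2 t_leq] := t_bounds j.
  have q_gt0 : 0 < (q j)%:R :> R by rewrite ltr0n (leq_trans _ t_leq) // ltnW.
  have t_ge1 : 1 <= (t j)%:R :> R by rewrite ler1n ltnW.
  have t2_small : (t j)%:R ^+ 2 <= c * (q j)%:R.
    rewrite -ler_pdivrMr //; apply: ltW; near: j.
    exact: (cvgr_lt _ t2q_0 _ c_gt0).
  have e_defect : defect R (q j) (t j) (E j) (e j) < theta / (t j)%:R ^+ 2.
    rewrite ltr_pdivlMr ?exprn_gt0 ?(lt_le_trans ltr01) //.
    have : (t j)%:R ^+ 3 * defect R (q j) (t j) (E j) (e j) < theta.
      by near: j; exact: (cvgr_lt _ t3defect_0 _ theta_gt0).
    have [d0|d0 _] := lerP 0 (defect R (q j) (t j) (E j) (e j)); last first.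
      by apply: (le_lt_trans _ theta_gt0); rewrite mulr_le0_ge0 ?sqr_ge0 ?ltW.
    apply: le_lt_trans; rewrite mulrC ler_wpM2r // exprS ler_peMl ?sqr_ge0 //.
  exact: (large_ratio (E_uniform j) (E_linear j) (E_crown_free j) t_ge2 t_leq
            theta_gt0 theta_lt1 erefl t2_small (e_edge j) e_defect).
- have error_0 : error j @[j --> \oo] --> (0 + 4 * 0 : R).
    by apply: cvgD => //; apply: cvgM => //; exact: cvg_cst.
  have : 1 - 70 / c ^+ 2 * error j @[j --> \oo] -->
      (1 - 70 / c ^+ 2 * (0 + 4 * 0) : R).
    by apply: cvgB; [exact: cvg_cst|apply: cvgM => //; exact: cvg_cst].
  by rewrite mulr0 addr0 mulr0 subr0.
- exact: cvg_cst.
Unshelve. all: by end_near.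
Qed.
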